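(* The tournament $\vec{T}_{\aleph_1}$ with vertex set $\mathbb{R}^2$ has uncountable dichromatic number; that is, there is no coloring of its vertices with countably many colors without monochromatic directed cycles.
   Context: The dichromatic number of an infinite digraph $\vec{G}$ is the smallest cardinal $\kappa$ for which $V(\vec{G})$ can be colored with $\kappa$ many colors avoiding monochromatic directed cycles (directed cycles are finite). The tournament $\vec{T}_{\aleph_1}$ (this symbol is just a name) is defined as follows. Its vertex set is $\mathbb{R}^2$. The vertices are totally ordered by: $(i_1,j_1)<(i_2,j_2)$ iff either $i_1<i_2$, or $i_1=i_2$ and $j_1<j_2$. For two distinct vertices $(i_1,j_1),(i_2,j_2)$: if $j_1=j_2$, the edge between them is directed from $(i_1,j_1)$ to $(i_2,j_2)$ iff $(i_1,j_1)<(i_2,j_2)$; if $j_1\neq j_2$, the edge between them is directed from $(i_1,j_1)$ to $(i_2,j_2)$ iff $(i_1,j_1)>(i_2,j_2)$. *)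

(* Defs.v *)
From HB Require Import structures.
From mathcomp Require Import all_boot all_order all_algebra.
From mathcomp Require Import boolp classical_sets functions cardinality reals.

Set Implicit Arguments.
Unset Strict Implicit.
Unset Printing Implicit Defensive.

Import Order.TTheory GRing.Theory Num.Theory.

Local Open Scope classical_set_scope.
Local Open Scope ring_scope.
Local Open Scope card_scope.

Section Dichromatic.
Variables (V : eqType) (arc : rel V).

(* A loop counts as a directed cycle of length 1 and a digon as one of length 2;
   neither occurs in a tournament. *)
Definition dicycle (c : seq V) : bool := [&& c != [::], cycle arc c & uniq c].

Definition monochromatic (K : Type) (f : V -> K) (c : seq V) : Prop :=
  exists k : K, forall x : V, x \in c -> f x = k.

Definition dicoloring (K : Type) (f : V -> K) : Prop :=
  forall c : seq V, dicycle c -> ~ monochromatic f c.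

Definition dicolorable (K : Type) : Prop :=
  exists f : V -> K, dicoloring f.

(* Cardinals are represented by types up to equipotence: the dichromatic number
   is the cardinality of K.  See [is_dichromatic_number_exists] and
   [is_dichromatic_number_unique]. *)
Definition is_dichromatic_number (K : Type) : Prop :=
  dicolorable K /\
  forall K' : Type, dicolorable K' -> [set: K] #<= [set: K'].

End Dichromatic.

Lemma card_leT_inj (K K' : Type) (f : K -> K') :
  injective f -> [set: K] #<= [set: K'].
Proof.
move=> finj.
have /card_eqPle[_ h] : range f #= [set: K].
  by apply: inj_card_eq => x y _ _; apply: finj.
exact: card_le_trans h (subset_card_le (@subsetT _ _)).
Qed.

Lemma least_card_exists (I : Type) (F : I -> Type) : inhabited I ->
  exists m : I, forall i : I, exists f : F m -> F i, injective f.
Proof.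
case=> i0.
pose T := forall i, F i.
pose P := [set S : set T | forall g h i, S g -> S h -> g i = h i -> g = h].
have [|S [PS maxS]] := @Zorn_bigcup T P.
  move=> C CP Ctot g h i [X CX Xg] [Y CY Yh] gh.
  have [XY|YX] := Ctot X Y CX CY.
    by apply: (CP Y CY g h i) => //; apply: XY.
  by apply: (CP X CX g h i) => //; apply: YX.
have [[m Sm]|nS] := pselect (exists m, forall y : F m, exists g, S g /\ g m = y).
  have [G GP] : {G : F m -> T & forall y, S (G y) /\ G y m = y}.
    by exists (fun y => sval (cid (Sm y))) => y; case: cid.
  exists m => i; exists (fun y => G y i) => x y /= xy.
  have [Sx <-] := GP x; have [Sy <-] := GP y.
  by rewrite (PS _ _ i Sx Sy xy).
exfalso.
have ex m : exists y : F m, forall g, S g -> g m <> y.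
  apply: contrapT => H; apply: nS; exists m => y.
  apply: contrapT => H'; apply: H; exists y => g Sg gy.
  by apply: H'; exists g.
pose g0 : T := fun m => sval (cid (ex m)).
have g0P m g : S g -> g m <> g0 m.
  by rewrite /g0; case: cid => y /= yP; apply: yP.
apply: (maxS (S `|` [set g0])).
  split; first by left.
  by move=> /(_ g0 (or_intror erefl)) /(g0P i0).
move=> g h i [Sg|->] [Sh|->] //.
- exact: PS.
- by move/(g0P i g Sg).
- by move/esym/(g0P i h Sh).
Qed.

Lemma is_dichromatic_number_exists (V : eqType) (arc : rel V) (K : Type) :
  dicolorable arc K -> exists K0 : Type, is_dichromatic_number arc K0.
Proof.
move=> colK.
have red (K' : Type) : dicolorable arc K' ->
    exists C : set V, dicolorable arc {x | C x} /\
      exists h : {x | C x} -> K', injective h.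
  move=> [f fP].
  have ex v : exists w, f w = f v by exists v.
  pose rep v := sval (cid (ex v)).
  have repP v : f (rep v) = f v by rewrite /rep; case: cid.
  have rep_eq v w : f v = f w -> rep v = rep w.
    move=> e; suff gen (P Q : set V) (HP : exists u, P u) (HQ : exists u, Q u) :
      P = Q -> sval (cid HP) = sval (cid HQ) by apply: gen; rewrite e.
    by move=> PQ; subst Q; rewrite (Prop_irrelevance HP HQ).
  exists (range rep); split.
    exists (fun v => exist (range rep) (rep v) (ex_intro2 _ _ v I erefl)).
    move=> c cP [k kP]; apply: (fP c cP); exists (f (sval k)) => x xc.
    by rewrite -(kP x xc) /= repP.
  exists (f \o sval) => -[x xC] [y yC] /= fxy; apply: eq_exist.
  case: xC yC => [v _ xE] [w _ yE]; rewrite -xE -yE; apply: rep_eq.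
  by rewrite -(repP v) -(repP w) xE yE.
have [C0 [C0P _]] := red K colK.
pose F (i : {C : set V | dicolorable arc {x | C x}}) := {x | sval i x}.
have [m mP] := @least_card_exists _ F (inhabits (exist _ C0 C0P)).
exists (F m); split; first by case: m {mP}.
move=> K' /red[C [CP [h hinj]]].
have [g ginj] := mP (exist _ C CP).
exact: (@card_leT_inj _ _ (h \o g) (inj_comp hinj ginj)).
Qed.

Lemma is_dichromatic_number_unique (V : eqType) (arc : rel V) (K K' : Type) :
  is_dichromatic_number arc K -> is_dichromatic_number arc K' ->
  [set: K] #= [set: K'].
Proof.
move=> [cK minK] [cK' minK']; apply/card_eqPle.
by split; [exact: minK | exact: minK'].
Qed.

Section Tournament.
Variable R : realType.

Definition vlt (u v : R * R) : bool :=
  (u.1 < v.1) || ((u.1 == v.1) && (u.2 < v.2)).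

Definition T_aleph1 : rel (R * R)%type := fun u v =>
  (u != v) && (if u.2 == v.2 then vlt u v else vlt v u).

Lemma T_aleph1_irr (u : R * R) : T_aleph1 u u = false.
Proof. by rewrite /T_aleph1 eqxx. Qed.

Lemma T_aleph1_tournament (u v : R * R) :
  u != v -> T_aleph1 u v (+) T_aleph1 v u.
Proof.
case: u v => [a b] [c d]; rewrite /T_aleph1 /vlt xpair_eqE [_ == (a, b)]xpair_eqE /=.
rewrite [c == a]eq_sym [d == b]eq_sym.
by case: (ltgtP a c); case: (ltgtP b d).
Qed.

Lemma T_aleph1_dichromatic_number_exists :
  exists K : Type, is_dichromatic_number T_aleph1 K.
Proof.
apply: (@is_dichromatic_number_exists _ _ (R * R)%type).
exists id => -[//|x [|y c]]; rewrite /dicycle /=; first by rewrite T_aleph1_irr.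
case/andP=> _ /andP[xyc _] [k kP]; move: xyc; rewrite inE negb_or => /andP[/eqP xy _]; apply: xy.
have xk : x = k by apply: kP; rewrite !inE eqxx.
by rewrite xk; apply/esym/kP; rewrite !inE eqxx orbT.
Qed.

End Tournament.

(* Main.v *)
Require Import Defs.
From mathcomp Require Import all_boot all_order all_algebra.
From mathcomp Require Import boolp classical_sets functions cardinality reals.
From mathcomp Require Import ereal lebesgue_measure.

Local Open Scope classical_set_scope.

Import Order.TTheory GRing.Theory Num.Theory.

(** Fix a colouring by a countable set K.  A line is uncountable, so every
    horizontal line of the plane contains two points [a < b] of the same colour
    [k] ([not_injective_to_countable]); choose a rational [q] between their
    abscissae.  There are uncountably many lines but only countably many pairs
    [(k, q)], so two different lines receive the same pair.  This yields two
    monochromatic segments of the same colour, on different lines, which both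
    cross the vertical line of abscissa [q].  Whichever segment starts
    lexicographically later starts between the two ends of the other one, and
    a point lexicographically between two points of another line closes a
    directed triangle with them ([T_aleph1_triangle]). *)

(** A countable line would have Lebesgue measure zero. *)
Lemma realType_uncountable (R : realType) : ~ countable [set: R].
Proof.
move=> Rc.
have : countable (`[0%R, 1%R] : set R).
  exact: sub_countable (subset_card_le (@subsetT _ _)) Rc.
move=> /countable_lebesgue_measure0.
rewrite lebesgue_measure_itv /= lte_fin ltr01 oppr0 adde0 => -[] /eqP.
by rewrite oner_eq0.
Qed.

Lemma not_injective_to_countable (R : realType) (K : Type) (f : R -> K) :
  countable [set: K] -> exists x y, (x < y)%R /\ f x = f y.
Proof.
move=> Kc; apply: contrapT => H; apply: (@realType_uncountable R).
apply: sub_countable Kc; apply: (@card_leT_inj _ _ f) => x y fxy.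
by case: (ltgtP x y) => // xy; case: H; [exists x, y | exists y, x].
Qed.

(** The arc [a -> b] runs forward because [a] and [b] share a line; the arcs
    [b -> c] and [c -> a] join different lines and so run backward. *)
Lemma T_aleph1_triangle (R : realType) (a b c : R * R) :
  a.2 = b.2 -> c.2 != a.2 -> vlt a c -> vlt c b ->
  dicycle (@T_aleph1 R) [:: a; b; c].
Proof.
case: a b c => [a j] [b _] [c i] /= <- ij; rewrite /vlt /= => ac cb.
(* Equal abscissae would put [c] both above and below the line of [a] and [b]. *)
have ab : (a < b)%R.
  by case/orP: ac cb => [ac|/andP[/eqP<- ji]] /orP[cb|/andP[/eqP<- ij']] //;
    [exact: lt_trans ac cb | have := lt_trans ji ij'; rewrite ltxx].
rewrite /dicycle /= /T_aleph1 /vlt /= !inE !xpair_eqE !negb_or.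
rewrite (lt_eqF ab) ab (eq_sym j i) (negbTE ij) eqxx !andbF /= ac cb.
by [].
Qed.

Lemma T_aleph1_not_dicolorable (R : realType) (K : Type) :
  countable [set: K] -> ~ dicolorable (@T_aleph1 R) K.
Proof.
move=> Kc [f fcol].
have ex j : exists kq : K * rat, exists a b : R,
    [/\ (a < ratr kq.2)%R, (ratr kq.2 < b)%R, f (a, j) = kq.1 & f (b, j) = kq.1].
  have [a [b [ab fab]]] := @not_injective_to_countable R K (fun x => f (x, j)) Kc.
  have [q] := rat_in_itvoo ab.
  by rewrite in_itv /= => /andP[aq qb]; exists (f (a, j), q), a, b.
have [code codeP] := choice ex.
have KQc : countable [set: K * rat].
  by rewrite -setXTT; apply: countableX => //; apply: countableP.
have [i [j [ij cij]]] := @not_injective_to_countable R _ code KQc.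
have [a [b [aq qb fa fb]]] := codeP i.
have [c [d [cq qd fc fd]]] := codeP j; rewrite -{}cij in cq qd fc fd.
have mono x y z k : f x = k -> f y = k -> f z = k ->
    dicycle (@T_aleph1 R) [:: x; y; z] -> False.
  move=> fx fy fz /fcol; apply; exists k => t.
  by rewrite !inE => /or3P[] /eqP->.
(* In case of a tie, the segment on the lower line starts first. *)
case: (leP a c) => ac.
  apply: (mono _ _ _ _ fa fb fc); apply: T_aleph1_triangle => //=.
  - by rewrite gt_eqF.
  - by rewrite /vlt /= ij andbT orbC -le_eqVlt.
  - by rewrite /vlt /= (lt_trans cq qb).
apply: (mono _ _ _ _ fc fd fa); apply: T_aleph1_triangle => //=.
- by rewrite lt_eqF.
- by rewrite /vlt /= ac.
- by rewrite /vlt /= (lt_trans aq qd).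
Qed.

Theorem theorem2p13 (R : realType) :
  (forall K : Type,
     is_dichromatic_number (@T_aleph1 R) K -> ~ countable [set: K]) /\
  (forall K : Type, countable [set: K] -> ~ dicolorable (@T_aleph1 R) K).
Proof.
split=> [K [Kcol _] Kc|K]; last exact: T_aleph1_not_dicolorable.
exact: T_aleph1_not_dicolorable Kc Kcol.
Qed.
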